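(* Let $\mathbb K$ be an algebraic number field, $R$ an order in $\mathbb K$, and $N=N_{\mathbb K|\mathbb Q}:\mathbb K\to\mathbb Q$ the norm map. Let $f=c_nX^n+\cdots+c_1X+c_0$ be a polynomial in $R[X]$ of degree $n\le 6$. (i) Suppose there is some $\mathfrak p\in\Pr R$ such that $\operatorname{ord}_{\mathfrak p}(c_n)=0$, $\gcd(n,\operatorname{ord}_{\mathfrak p}(c_0))=1$ and $(n-j)\operatorname{ord}_{\mathfrak p}(c_0)\le n\operatorname{ord}_{\mathfrak p}(c_j)$ for $j=1,\ldots,n-1$. Then $f$ is irreducible over $R$. (ii) Suppose moreover that $\mathbb K$ is a normal field of degree $m$ over $\mathbb Q$ with Galois group $G_{\mathbb K}$, and that $R$ is $G_{\mathbb K}$-invariant. Let $p\in\Pr\mathbb Z$ be such that there is some $\mathfrak p\in R$ with $N(\mathfrak p)=p$. Suppose further that $\gcd(n,m)=1$ and that for $\ell=\operatorname{ord}_p(c_0)$ the following hold: (1) $\operatorname{ord}_p(N(c_n))=0=\operatorname{ord}_p(N(c_0/p^{\ell}))$; (2) $\gcd(n,\ell)=1$; (3) $(n-j)\ell\le n\operatorname{ord}_p(c_j)$ for $j=1,\ldots,n-1$. Then $f$ is irreducible over $R$. (iii) Let $\delta\in\mathbb Z$ be cube-free, let $\alpha$ be the real cube root of $\delta$, and suppose $\mathbb K=\mathbb Q(\alpha)$ is a pure cubic field and $R=\mathbb Z[\alpha]$. Let $p\in\Pr\mathbb Z$ with $p\ne\pm3$ be such that $\gcd(p,\delta)=1$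 and there is some $\mathfrak p\in\Pr R$ with $N(\mathfrak p)=p$. Write $\mathfrak p=a+b\alpha+c\alpha^2$ with $a,b,c\in\mathbb Z$ and suppose that $p\nmid ab-c^2\delta$ or $p\nmid ac-b^2$. Let $\ell=\operatorname{ord}_p(c_0)$ and suppose: (1) $\operatorname{ord}_p(N(c_n))=0=\operatorname{ord}_p(N(c_0/p^{\ell}))$; (2) $\gcd(n,\ell)=1$; (3) $(n-j)\ell\le n\operatorname{ord}_p(c_j)$ for $j=1,\ldots,n-1$. Then $f$ is irreducible over $R$.
   Context: For a ring $R$, $\Pr R$ denotes the set of prime elements of $R$: nonzero non-units $q$ such that $q\mid xy$ implies $q\mid x$ or $q\mid y$ (so $\Pr\mathbb Z$ contains both positive and negative primes). ''$f$ is irreducible over $R$'' means that $f$ is not a product of two nonconstant polynomials from $R[X]$. Let $R$ be a Noetherian integral domain (such as $\mathbb Z$ or an order) and $q\in R$ a nonzero non-unit. For $0\ne x\in R$, $\operatorname{ord}_q(x)$ is the unique $k\in\mathbb N_0$ with $q^k\mid x$ and $q^{k+1}\nmid x$ in $R$, and $\operatorname{ord}_q(0)=+\infty$. In (i)--(iii), $\operatorname{ord}_{\mathfrak p}(c_j)$ and $\operatorname{ord}_p(c_j)$ are computed in $R$, while $\operatorname{ord}_p(N(\cdot))$ is the usual $p$-order in $\mathbb Z$. The gcd conditions presuppose that the order of $c_0$ is finite, i.e. $c_0\ne0$. An order in $\mathbb K$ is a subring of the ring of integers $\mathcal O_{\mathbb K}$, containing $1$, of finite index in $\mathcal O_{\mathbb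 K}$. $R$ is $G_{\mathbb K}$-invariant if $\sigma(R)=R$ for every $\sigma\in G_{\mathbb K}=\mathrm{Gal}(\mathbb K|\mathbb Q)$. ''Pure cubic field'' means $[\mathbb Q(\alpha):\mathbb Q]=3$ (so $\delta\neq 0,\pm1$). *)

(* Defs.v *)
From mathcomp Require Import all_boot all_order all_algebra all_field.
From mathcomp Require Import boolp classical_sets constructive_ereal.

Set Implicit Arguments.
Unset Strict Implicit.
Unset Printing Implicit Defensive.

Import Order.TTheory GRing.Theory Num.Theory.
Local Open Scope ring_scope.

(* A ring is given as a subset S of an ambient field F; divisibility, prime
   elements and orders are always relative to S. *)

Definition dvd_in (F : fieldType) (S : {pred F}) (x y : F) : Prop :=
  exists2 z, z \in S & y = x * z.

Definition unit_in (F : fieldType) (S : {pred F}) (x : F) : Prop :=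
  exists2 y, y \in S & x * y = 1.

Definition Pr (F : fieldType) (S : {pred F}) (q : F) : Prop :=
  [/\ q \in S, q != 0, ~ unit_in S q
    & forall x y, x \in S -> y \in S ->
        dvd_in S q (x * y) -> dvd_in S q x \/ dvd_in S q y].

(* For x != 0 the set below has exactly one element whenever S is a Noetherian
   domain, q a nonzero non-unit of S and x in S; the default value 0 of xget is
   only returned outside that situation. *)
Definition ord_in (F : fieldType) (S : {pred F}) (q x : F) : \bar int :=
  if x == 0 then +oo%E
  else (Posz (xget 0%N
          [set k : nat | dvd_in S (q ^+ k) x /\ ~ dvd_in S (q ^+ k.+1) x]))%:E.

Definition ZZ : {pred rat} := [pred x : rat | x \is a Num.int].

(* An algebraic number field is a K : fieldExtType rat, that is, a field
   extension of finite degree \dim {:K} of the rationals. *)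

(* The determinant of the Q-linear map y |-> x * y. *)
Definition normQ (K : fieldExtType rat) (x : K) : rat :=
  \det (passmx.mxof (vbasis {:K}) (vbasis {:K}) (amull x)).

Definition alg_integer (K : fieldExtType rat) (x : K) : Prop :=
  integralOver (intr : int -> K) x.

(* Finite index: the finitely many cosets y + R, for y in s, cover the ring of
   integers. *)
Definition order_of (K : fieldExtType rat) (R : {pred K}) : Prop :=
  [/\ subring_closed R,
      forall x, x \in R -> alg_integer x
    & exists s : seq K, forall x, alg_integer x ->
        exists2 y, y \in s & x - y \in R].

Definition irreducible_over (F : fieldType) (S : {pred F}) (f : {poly F}) :
    Prop :=
  ~ exists g h : {poly F},
      [/\ g \is a polyOver S, h \is a polyOver S,
          (1 < size g)%N, (1 < size h)%N & f = g * h].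

Definition normal_field (K : fieldExtType rat) : Prop :=
  splitting_field_axiom K.

Definition Galois_invariant (K : fieldExtType rat) (R : {pred K}) : Prop :=
  forall s : 'End(K), kAut 1 {:K} s ->
    forall y, y \in R <-> exists2 x, x \in R & y = s x.

Definition cube_free (d : int) : Prop :=
  forall q : nat, prime q -> ~~ ((q%:Z ^+ 3) %| d)%Z.

(* alpha in K is the real cube root of d, K being viewed as a subfield of the
   complex numbers through some embedding. *)
Definition real_cube_root (K : fieldExtType rat) (d : int) (alpha : K) : Prop :=
  alpha ^+ 3 = d%:~R /\
  exists iota : {rmorphism K -> algC}, iota alpha \is Num.real.

Definition is_Zadjoin (K : fieldExtType rat) (alpha : K) (R : {pred K}) : Prop :=
  forall x, x \in R <-> exists g : {poly int}, x = (map_poly intr g).[alpha].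

(* Main.v *)
Require Import Defs.
From HB Require Import structures.
From mathcomp Require Import all_boot all_order all_fingroup all_algebra all_field.
From mathcomp Require Import boolp classical_sets constructive_ereal.
From mathcomp Require Import zify ring.

Set Implicit Arguments.
Unset Strict Implicit.
Unset Printing Implicit Defensive.

Import Order.TTheory GRing.Theory Num.Theory passmx.
Local Open Scope ring_scope.

(** All three parts rest on one argument about Newton polygons
    ([dumas_irreducible]).  A prime element q of R, whose powers cannot all
    divide the same nonzero element, gives a valuation v on R.  The hypotheses
    say that the points (j, v c_j) lie on or above the segment from (0, v c_0)
    to (n, 0), whose ends are attained.  If f = g h with g of degree r, then the
    polygons of g and h are parallel pieces of that segment, so that
    n v(g_0) = r v(c_0).  As n is coprime to v(c_0), it divides r, which forces
    r = 0 or r = n.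

    Part (i) is this criterion, once powers of a nonunit are known not to divide
    a nonzero element of R indefinitely.  That follows from the norm: it is
    multiplicative, integral on R ([alg_integer_norm]), and x divides N(x) in R
    ([order_dvd_norm]), so that an element of norm 1 or -1 is a unit.

    Parts (ii) and (iii) are reduced to the same criterion for q with N(q) = p.
    Write p = q^e u with u in R and q not dividing u.  As p divides neither
    N(c_n) nor N(c_0 / p^l), the q-orders of c_n and c_0 are 0 and e l, and the
    other inequalities are multiplied by e; so it is enough that n is coprime to
    e ([rational_prime_criterion]).

    In (ii), q is prime because q R has prime index |p| in R, hence is a maximal
    ideal ([prime_norm_Pr]); this uses integral bases of R and of the ideals
    between q R and R, found by minimizing the discriminant ([lattice_basis]).
    The product of the conjugates of q is rational and has norm p^m, so it is p
    or -p.  Therefore e counts the automorphisms s such that q divides s(q),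
    which form a subgroup of the Galois group, and e divides m
    ([galois_ramification]).

    In (iii), e = 1: if p = q z with q dividing z, then p divides z^2, and since
    X^3 - delta is separable modulo p (as p does not divide 3 delta), p divides
    z, which makes q a unit ([cubic_unramified]). *)

(** * Divisibility and orders at a prime element *)

Definition ordn (F : fieldType) (S : {pred F}) (q x : F) : nat :=
  xget 0%N [set k : nat | dvd_in S (q ^+ k) x /\ ~ dvd_in S (q ^+ k.+1) x].

Lemma ord_inE (F : fieldType) (S : {pred F}) (q x : F) :
  ord_in S q x = if x == 0 then +oo%E else ((ordn S q x)%:Z)%:E.
Proof. by []. Qed.

Section Divisibility.
Variables (F : fieldType) (S : {pred F}) (SS : subring_closed S).
#[local] HB.instance Definition _ := GRing.isSubringClosed.Build F S SS.
Implicit Types x y z : F.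

Lemma dvd_in0 x : dvd_in S x 0.
Proof. by exists 0; rewrite ?mulr0 ?rpred0. Qed.

Lemma dvd_inD x y z : dvd_in S x y -> dvd_in S x z -> dvd_in S x (y + z).
Proof. by case=> u uS -> [w wS ->]; exists (u + w); rewrite ?rpredD ?mulrDr. Qed.

Lemma dvd_inB x y z : dvd_in S x y -> dvd_in S x z -> dvd_in S x (y - z).
Proof. by case=> u uS -> [w wS ->]; exists (u - w); rewrite ?rpredB ?mulrBr. Qed.

Lemma dvd_in_sum (I : Type) (r : seq I) (P : pred I) (G : I -> F) x :
  (forall i, P i -> dvd_in S x (G i)) -> dvd_in S x (\sum_(i <- r | P i) G i).
Proof.
move=> xG; elim/big_ind: _ => //; first exact: dvd_in0.
by move=> y z; apply: dvd_inD.
Qed.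

Lemma dvd_in_trans x y z : dvd_in S x y -> dvd_in S y z -> dvd_in S x z.
Proof.
by case=> u uS -> [w wS ->]; exists (u * w); rewrite ?rpredM // mulrA.
Qed.

Lemma dvd_inM x y z t : dvd_in S x y -> dvd_in S z t -> dvd_in S (x * z) (y * t).
Proof.
by case=> u uS -> [w wS ->]; exists (u * w); rewrite ?rpredM // mulrACA.
Qed.

Lemma dvd_in_mulr x y : y \in S -> dvd_in S x (x * y).
Proof. by move=> yS; exists y. Qed.

Lemma dvd_in_exp x k l : x \in S -> (k <= l)%N -> dvd_in S (x ^+ k) (x ^+ l).
Proof. by move=> xS kl; exists (x ^+ (l - k)); rewrite ?rpredX // -exprD subnKC. Qed.

Lemma dvd_in_ordn q x : x \in S -> dvd_in S (q ^+ ordn S q x) x.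
Proof.
move=> xS; rewrite /ordn; case: xgetP => [k _ [] //|_].
by exists x; rewrite // mul1r.
Qed.

End Divisibility.

Section Dumas.
Variables (F : fieldType) (S : {pred F}) (SS : subring_closed S).
#[local] HB.instance Definition _ := GRing.isSubringClosed.Build F S SS.
Variables (q : F) (q_prime : Pr S q).
Hypothesis q_finite :
  forall x, x \in S -> x != 0 -> exists k, ~ dvd_in S (q ^+ k) x.
Implicit Types (x y z : F) (g h : {poly F}).

Let v := ordn S q.
Let qS : q \in S. Proof. by case: q_prime. Qed.
Let q0 : q != 0. Proof. by case: q_prime. Qed.

(** Finiteness rules out the default value of [xget]: were no exponent exact,
    every power of q would divide x, by induction on the exponent. *)
Lemma ordn_max x : x \in S -> x != 0 -> ~ dvd_in S (q ^+ (v x).+1) x.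
Proof.
move=> xS x0; rewrite /v /ordn; case: xgetP => [k _ [] //|none].
have [k] := q_finite xS x0; elim: k => [|k IH] nk.
  by case: nk; exists x; rewrite // mul1r.
by have [dk|/IH //] := pselect (dvd_in S (q ^+ k) x); case: (none k).
Qed.

Lemma dvd_in_leq_ordn x k :
  x \in S -> x != 0 -> dvd_in S (q ^+ k) x -> (k <= v x)%N.
Proof.
move=> xS x0 dk; rewrite leqNgt; apply/negP => lt_vk.
by apply: (ordn_max xS x0); apply: dvd_in_trans dk => //; apply: dvd_in_exp.
Qed.

Lemma ordn_eq x k : x \in S ->
  dvd_in S (q ^+ k) x -> ~ dvd_in S (q ^+ k.+1) x -> v x = k.
Proof.
move=> xS dk ndk; have x0 : x != 0.
  by apply/eqP => x0; apply: ndk; rewrite x0; apply: dvd_in0.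
apply/eqP; rewrite eqn_leq dvd_in_leq_ordn // andbT leqNgt.
apply/negP => lt_kv; apply: ndk.
by apply: dvd_in_trans (dvd_in_ordn q xS) => //; apply: dvd_in_exp.
Qed.

Lemma not_dvd_in_mul_exp k u :
  u \in S -> ~ dvd_in S q u -> ~ dvd_in S (q ^+ k.+1) (q ^+ k * u).
Proof.
move=> uS nqu [w wS]; rewrite exprSr -mulrA => /mulfI e.
by apply: nqu; exists w; rewrite // e // expf_neq0.
Qed.

Lemma ordn_mul_exp k u : u \in S -> ~ dvd_in S q u -> v (q ^+ k * u) = k.
Proof.
move=> uS nqu; apply: ordn_eq; first by rewrite rpredM ?rpredX.
  exact: dvd_in_mulr.
exact: not_dvd_in_mul_exp.
Qed.

Lemma ordn_decomp x : x \in S -> x != 0 ->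
  exists2 u, u \in S & x = q ^+ v x * u /\ ~ dvd_in S q u.
Proof.
move=> xS x0; have [u uS xE] := dvd_in_ordn q xS.
exists u; rewrite // -xE; split=> // [[w wS uE]].
by apply: (ordn_max xS x0); exists w; rewrite // exprSr -mulrA -uE.
Qed.

Lemma ordnM x y : x \in S -> y \in S -> x != 0 -> y != 0 ->
  v (x * y) = (v x + v y)%N.
Proof.
move=> xS yS x0 y0.
have [u uS [{1}-> nu]] := ordn_decomp xS x0.
have [w wS [{1}-> nw]] := ordn_decomp yS y0.
have [_ _ _ q_euclid] := q_prime.
by rewrite mulrACA -exprD ordn_mul_exp ?rpredM // => /(q_euclid _ _ uS wS)[].
Qed.

(** * The irreducibility criterion *)

(** The minimal value is found first and the first index attaining it second,
    whence the strict inequality before that index. *)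
Lemma exists_first_min (P : pred nat) (w : nat -> nat) i :
  P i -> exists i0, [/\ P i0, forall j, P j -> (w i0 <= w j)%N
                      & forall j, P j -> (j < i0)%N -> (w i0 < w j)%N].
Proof.
move=> Pi.
have exv : exists m, `[< exists2 k, P k & w k = m >].
  by exists (w i); apply/asboolP; exists i.
case: (ex_minnP exv) => m /asboolP[k0 Pk0 Fk0] vmin.
have exk : exists k, P k && (w k == m) by exists k0; rewrite Pk0 Fk0 eqxx.
case: (ex_minnP exk) => i0 /andP[Pi0 /eqP Fi0] i0min.
have le_F j : P j -> (w i0 <= w j)%N.
  by move=> Pj; rewrite Fi0; apply: vmin; apply/asboolP; exists j.
exists i0; split=> // j Pj ltj; rewrite ltn_neqAle le_F // andbT Fi0.
by apply: contraL ltj => /eqP Fj; rewrite -leqNgt i0min // Pj Fj eqxx.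
Qed.

(** The product formula for Newton polygons, for the linear form
    n v + l k on the points (k, v).  The first indices i and j minimizing the
    form on g and h are taken; then g_i h_j is the only term of the coefficient
    i + j of g h whose order is as small as v g_i + v h_j, since in any other
    term one of the two indices is smaller than i or j. *)
Lemma dominant_coef_mul (n l : nat) g h :
    g \is a polyOver S -> h \is a polyOver S -> g != 0 -> h != 0 ->
  exists i j,
  [/\ forall k, g`_k != 0 -> (n * v g`_i + i * l <= n * v g`_k + k * l)%N,
      forall k, h`_k != 0 -> (n * v h`_j + j * l <= n * v h`_k + k * l)%N
    & ~ dvd_in S (q ^+ (v g`_i + v h`_j).+1) (g * h)`_(i + j)].
Proof.
move=> /polyOverP gS /polyOverP hS g0 h0.
have [i [gi0 gmin gfst]] := @exists_first_min (fun k => g`_k != 0)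
  (fun k => n * v g`_k + k * l)%N (size g).-1
  (negbT (etrans (lead_coef_eq0 g) (negbTE g0))).
have [j [hj0 hmin hfst]] := @exists_first_min (fun k => h`_k != 0)
  (fun k => n * v h`_k + k * l)%N (size h).-1
  (negbT (etrans (lead_coef_eq0 h) (negbTE h0))).
exists i, j; split=> //.
have lti : (i < (i + j).+1)%N by rewrite ltnS leq_addr.
rewrite coefM (bigD1 (Ordinal lti)) //= addKn.
set rest := \sum_(_ < _ | _) _; set A := (v g`_i + v h`_j)%N.
have d_rest : dvd_in S (q ^+ A.+1) rest.
  apply: dvd_in_sum => // k /eqP nki.
  have {nki} nki : (k : nat) != i.
    by apply: contra_notN nki => /eqP ki; apply: val_inj.
  have [->|gk0] := eqVneq g`_k 0; first by rewrite mul0r; apply: dvd_in0.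
  have [->|hk0] := eqVneq h`_(i + j - k) 0; first by rewrite mulr0; apply: dvd_in0.
  have ltA : (A < v g`_k + v h`_(i + j - k))%N.
    have := ltn_ord k; rewrite ltnS => lek.
    have := gmin _ gk0; have := hmin _ hk0; have := gfst _ gk0; have := hfst _ hk0.
    move: nki lek; rewrite /A; move: (v _) (v _) (v _) (v _) => a b c d.
    case: (ltngtP k i) => // [lki|lki] _ lek /= Hh Hg Hh' Hg'; nia.
  apply: dvd_in_trans (dvd_inM _ (dvd_in_ordn q (gS k)) (dvd_in_ordn q (hS _))) => //.
  by rewrite -exprD; apply: dvd_in_exp.
move=> dAll; have := dvd_inB SS dAll d_rest; rewrite addrK /A.
by rewrite -ordnM //; apply: ordn_max; rewrite ?rpredM ?mulf_neq0.
Qed.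

(** The order of a middle coefficient enters only through powers of q dividing
    it, so that a zero coefficient needs no infinite order. *)
Lemma dumas_irreducible (f : {poly F}) (n l : nat) :
    f \is a polyOver S -> size f = n.+1 ->
    ~ dvd_in S q f`_n ->
    dvd_in S (q ^+ l) f`_0 -> ~ dvd_in S (q ^+ l.+1) f`_0 ->
    coprime n l ->
    (forall j, (0 < j < n)%N ->
       exists2 k, dvd_in S (q ^+ k) f`_j & ((n - j) * l <= n * k)%N) ->
  irreducible_over S f.
Proof.
move=> fS sf nqn dl ndl co_nl Hj [g [h [gS hS sg sh fE]]].
have g0 : g != 0 by rewrite -size_poly_gt0; lia.
have h0 : h != 0 by rewrite -size_poly_gt0; lia.
have /polyOverP gSi := gS; have /polyOverP hSi := hS.
have [i [j [gmin hmin]]] := dominant_coef_mul n l gS hS g0 h0.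
rewrite -fE; set A := (_ + _)%N => nA.
(* The degree, one less than the size, is additive. *)
have sgh : ((size g).-1 + (size h).-1 = n)%N.
  move: (size_mul g0 h0) sg sh; rewrite -fE sf.
  by case: (size g) (size h) => [|a] [|b] //=; rewrite addnS => -[<-].
have leij : (i + j <= n)%N.
  rewrite leqNgt; apply/negP => ltn; apply: nA.
  by rewrite nth_default ?sf //; apply: dvd_in0.
(* The point (i + j, A) of g h = f lies on or above the polygon of f. *)
have fij : (n * l <= n * A + (i + j) * l)%N.
  have [k dk lek] : exists2 k, dvd_in S (q ^+ k) f`_(i + j)
                        & ((n - (i + j)) * l <= n * k)%N.
    have [ij0|ij0] := posnP (i + j)%N; first by exists l; rewrite ?ij0 ?subn0.
    have [ijn|ijn] := eqVneq (i + j)%N n.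
      exists 0%N; last by rewrite ijn subnn.
      by exists f`_(i + j); rewrite ?mul1r //; move/polyOverP: fS.
    by apply: Hj; rewrite ij0 ltn_neqAle ijn.
  have leA : (k <= A)%N.
    rewrite leqNgt; apply/negP => ltAk; apply: nA.
    by apply: dvd_in_trans dk => //; apply: dvd_in_exp.
  by have := leq_mul (leqnn n) leA; move: lek; rewrite mulnBl; lia.
have lead_f : f`_n = lead_coef g * lead_coef h.
  by rewrite -lead_coefM -fE lead_coefE sf.
have vlead (p : {poly F}) : p \is a polyOver S -> dvd_in S (lead_coef p) f`_n ->
    v (lead_coef p) = 0%N.
  move=> /polyOverP pS dp; have lS : lead_coef p \in S by rewrite lead_coefE.
  apply: ordn_eq => //; first by exists (lead_coef p); rewrite ?mul1r.
  by rewrite expr1 => qp; apply: nqn; apply: dvd_in_trans dp.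
have vg : v (lead_coef g) = 0%N.
  by apply: vlead => //; rewrite lead_f; apply: dvd_in_mulr; rewrite lead_coefE.
have vh : v (lead_coef h) = 0%N.
  by apply: vlead => //; rewrite lead_f mulrC; apply: dvd_in_mulr; rewrite lead_coefE.
have f00 : f`_0 = g`_0 * h`_0 by rewrite fE coefM big_ord1.
have f0n : f`_0 != 0.
  by apply/eqP => f00'; apply: ndl; rewrite f00'; apply: dvd_in0.
have [g00 h00] : g`_0 != 0 /\ h`_0 != 0.
  by move: f0n; rewrite f00 mulf_eq0 negb_or => /andP.
have v0 : (v g`_0 + v h`_0 = l)%N.
  by rewrite -ordnM // -f00; apply: ordn_eq => //; move/polyOverP: fS.
(* Both minima are bounded by the values at the two ends, and these bounds add
   up to n l for either choice of ends, so that they are all equalities. *)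
have := gmin _ g00; have := hmin _ h00.
have := gmin (size g).-1; have := hmin (size h).-1.
rewrite -!lead_coefE !lead_coef_eq0 vg vh => /(_ h0) + /(_ g0).
rewrite !mul0n !muln0 !addn0 !add0n => hr gr hz gz.
have divr : (n * v g`_0 = (size g).-1 * l)%N by move: fij; rewrite /A; nia.
have : (n %| (size g).-1)%N.
  by rewrite -(Gauss_dvdl _ co_nl) -divr dvdn_mulr.
by move/dvdn_leq; lia.
Qed.

End Dumas.

(** * Norms of algebraic integers *)

Section Norm.
Variable K : fieldExtType rat.
Implicit Types x y : K.

Definition mulmat x : 'M[rat]_(\dim {:K}) :=
  mxof (vbasis {:K}) (vbasis {:K}) (amull x).

Notation coords := (rVof (vbasis {:K})).

Lemma normQE x : normQ x = \det (mulmat x). Proof. by []. Qed.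

Lemma coordsM x y : coords (x * y) = coords y *m mulmat x.
Proof. by rewrite -(rVof_app _ (vbasisP _)) lfunE. Qed.

Lemma mulmatM x y : mulmat (x * y) = mulmat y *m mulmat x.
Proof.
rewrite /mulmat; have -> : amull (x * y) = (amull x \o amull y)%VF.
  by apply/lfunP => z; rewrite comp_lfunE !lfunE /= mulrA.
by rewrite (mxof_comp _ _ (vbasisP _)).
Qed.

Lemma mulmat1 : mulmat 1 = 1%:M.
Proof. by rewrite /mulmat amull1 mxof1 // (basis_free (vbasisP _)). Qed.

Lemma mulmatZ a x : mulmat (a *: x) = a *: mulmat x.
Proof.
rewrite /mulmat; have -> : amull (a *: x) = a *: amull x.
  by apply/lfunP => z; rewrite scale_lfunE !lfunE /= scalerAl.
by apply/matrixP => i j; rewrite !mxE /= scale_lfunE linearZ.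
Qed.

Lemma mulmat0 : mulmat 0 = 0.
Proof. by rewrite -(scale0r 1) mulmatZ scale0r. Qed.

Lemma normQM x y : normQ (x * y) = normQ x * normQ y.
Proof. by rewrite !normQE mulmatM det_mulmx mulrC. Qed.

Lemma normQ1 : normQ (1 : K) = 1.
Proof. by rewrite normQE mulmat1 det1. Qed.

Lemma normQ_scalar a : normQ (a%:A : K) = a ^+ \dim {:K}.
Proof. by rewrite normQE mulmatZ mulmat1 scalemx1 det_scalar. Qed.

Lemma normQX x k : normQ (x ^+ k) = normQ x ^+ k.
Proof. by elim: k => [|k IH]; rewrite ?expr0 ?normQ1 // !exprS normQM IH. Qed.

Lemma normQ_eq0 x : (normQ x == 0) = (x == 0).
Proof.
have [->|x0] := eqVneq x 0.
  have := normQ_scalar 0; rewrite scale0r expr0n gtn_eqF ?adim_gt0 // => ->.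
  by rewrite !eqxx.
apply/negbTE/negP => /eqP N0; have /eqP := normQM x x^-1.
by rewrite mulfV // normQ1 N0 mul0r oner_eq0.
Qed.

Lemma mulmatD x y : mulmat (x + y) = mulmat x + mulmat y.
Proof.
rewrite /mulmat; have -> : amull (x + y) = amull x + amull y.
  by apply/lfunP => z; rewrite add_lfunE !lfunE /= mulrDl.
by apply/matrixP => i j; rewrite !mxE /= add_lfunE linearD.
Qed.

Lemma mulmat_int (c : int) : mulmat c%:~R = (c%:~R)%:M.
Proof.
by rewrite -[c%:~R in LHS](rmorph_int (in_alg K)) /= mulmatZ mulmat1 scalemx1.
Qed.

Lemma row_mulmat x i : row i (mulmat x) = coords (x * (vbasis {:K})`_i).
Proof. by rewrite coordsM rVofE ?vbasisP // -rowE. Qed.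

End Norm.

Local Notation coords := (rVof (vbasis {:_})).

Lemma intr_alg (K : fieldExtType rat) (c : int) : c%:~R = (c%:~R)%:A :> K.
Proof. by rewrite -[LHS](rmorph_int (in_alg K)). Qed.

Lemma intr_alg_eq0 (K : fieldExtType rat) (c : int) :
  ((c%:~R : K) == 0) = (c == 0).
Proof. by rewrite intr_alg scaler_eq0 oner_eq0 orbF intr_eq0. Qed.

Lemma char_poly_tr (S : comNzRingType) d (A : 'M[S]_d) :
  char_poly A^T = char_poly A.
Proof.
rewrite /char_poly -[RHS]det_tr; congr (\det _).
by apply/matrixP => i j; rewrite !mxE eq_sym.
Qed.

Lemma root_char_poly_col (L : fieldType) d (B : 'M[L]_d) (c : 'cV[L]_d) y :
  c != 0 -> B *m c = y *: c -> root (char_poly B) y.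
Proof.
move=> c0 Bc; rewrite -char_poly_tr -eigenvalue_root_char; apply/eigenvalueP.
exists c^T; first by rewrite -trmx_mul Bc linearZ.
by apply: contra c0 => /eqP c0; rewrite -[c]trmxK c0 trmx0.
Qed.

Lemma int_mx_clear d (A : 'M[rat]_d) :
  exists2 D : int, D != 0 & exists B : 'M[int]_d, D%:~R *: A = map_mx intr B.
Proof.
pose D := \prod_(ij : 'I_d * 'I_d) denq (A ij.1 ij.2).
exists D; first by apply/prodf_neq0 => ij _; apply: denq_neq0.
exists (map_mx numq (D%:~R *: A)); apply/matrixP => i j; rewrite !mxE numqK //.
rewrite /D (bigD1 (i, j)) //= rmorphM /= mulrAC [_ * A i j]mulrC -numqE.
by rewrite -intrM intr_int.
Qed.

Section Integrality.
Variable K : fieldExtType rat.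
Implicit Types x y : K.

Definition basis_col : 'cV[K]_(\dim {:K}) := \col_i (vbasis {:K})`_i.

Lemma basis_col_neq0 : basis_col != 0.
Proof.
have d0 := adim_gt0 {:K}%AS; have /basis_free := vbasisP {:K}%VS.
move/free_not0 => nz; apply/eqP => /matrixP/(_ (Ordinal d0) 0).
rewrite !mxE /= => /eqP; apply/negP/nz/mem_nth.
by rewrite size_tuple.
Qed.

Lemma mulmat_basis_col x :
  map_mx (in_alg K) (mulmat x) *m basis_col = x *: basis_col.
Proof.
apply/colP => i; rewrite !mxE.
rewrite -[RHS](rVofK (vbasisP _)) -row_mulmat /vecof.
by apply: eq_bigr => j _; rewrite !mxE /= mulr_algl.
Qed.

(** The basis, as a column over K, is an eigenvector of the matrix of x for the
    eigenvalue x itself; this replaces the theorem of Cayley and Hamilton and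
    holds without writing the dimension as a successor. *)
Lemma root_char_mulmat x :
  root (map_poly (in_alg K) (char_poly (mulmat x))) x.
Proof.
rewrite map_char_poly.
exact: root_char_poly_col basis_col_neq0 (mulmat_basis_col x).
Qed.

(** Over the algebraic numbers, an eigenvalue z of the matrix of x satisfies
    every integral equation that x satisfies. *)
Lemma mulmat_horner_eigen x (v : 'rV[algC]_(\dim {:K})) z (p : {poly int}) :
  v *m map_mx ratr (mulmat x) = z *: v ->
  v *m map_mx ratr (mulmat (map_poly intr p).[x]) = (map_poly intr p).[z] *: v.
Proof.
move=> vx; elim/poly_ind: p => [|p c IH].
  by rewrite !rmorph0 !horner0 scale0r mulmat0 map_mx0 mulmx0.
rewrite !rmorphD !rmorphM /= !map_polyX !map_polyC !hornerE /=.
rewrite mulmatD mulrC mulmatM mulmat_int map_mxD map_mxM mulmxDr mulmxA.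
rewrite IH -scalemxAl vx map_scalar_mx /= ratr_int scalerA.
by rewrite mul_mx_scalar scalerDl.
Qed.

Lemma ratr_int_inv (a : rat) : (ratr a : algC) \is a Num.int -> a \is a Num.int.
Proof.
by case/intrP => m; rewrite -(ratr_int algC) => /fmorph_inj ->; apply: intr_int.
Qed.

(** The roots of the characteristic polynomial are algebraic integers, because
    they satisfy the monic equation of x; its coefficients are then rational
    algebraic integers. *)
Lemma char_poly_int x :
  alg_integer x -> char_poly (mulmat x) \is a polyOver Num.int.
Proof.
case=> p mon_p px0; have [r Dr] := closed_field_poly_normal
  (char_poly (map_mx (ratr : rat -> algC) (mulmat x))).
rewrite (monicP (char_poly_monic _)) scale1r in Dr.
have Ar z : z \in r -> z \in Aint.
  move=> rz; have : root (char_poly (map_mx (ratr : rat -> algC) (mulmat x))) z.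
    by rewrite Dr root_prod_XsubC.
  rewrite -eigenvalue_root_char => /eigenvalueP[v vz v0].
  have := mulmat_horner_eigen p vz.
  rewrite (rootP px0) mulmat0 map_mx0 mulmx0.
  move/esym/eqP; rewrite scaler_eq0 (negbTE v0) orbF => pz.
  apply: (@root_monic_Aint (map_poly intr p)) => //; first exact: monic_map.
  by apply/polyOverP => i; rewrite coef_map /= intr_int.
have AP : char_poly (map_mx (ratr : rat -> algC) (mulmat x)) \is a polyOver Aint.
  by rewrite Dr big_seq; apply: rpred_prod => z rz; rewrite polyOverXsubC Ar.
apply/polyOverP => i; apply: ratr_int_inv; apply: Cint_rat_Aint.
  exact: Crat_rat.
by rewrite -coef_map /= map_char_poly; move/polyOverP: AP.
Qed.

Lemma alg_integer_norm x : alg_integer x -> normQ x \is a Num.int.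
Proof.
move/char_poly_int/polyOverP/(_ 0%N); rewrite char_poly_det -normQE => ix.
by rewrite -[normQ x](signrMK (\dim {:K})) rpredM // rpredX ?rpredN1.
Qed.

(** A multiple D y whose matrix is integral is a root of the characteristic
    polynomial of that matrix, which is monic with integer coefficients. *)
Lemma alg_integer_multiple (y : K) :
  exists2 D : int, D != 0 & alg_integer (D%:~R * y).
Proof.
have [D D0 [B BE]] := int_mx_clear (mulmat y); exists D => //.
exists (char_poly B); first exact: char_poly_monic.
have -> : map_poly intr (char_poly B) =
    map_poly (in_alg K) (char_poly (mulmat (D%:~R * y))).
  rewrite [D%:~R]intr_alg mulr_algl mulmatZ BE.
  rewrite -[char_poly (map_mx _ _)]map_char_poly -map_poly_comp.
  by apply: eq_map_poly => c /=; rewrite -intr_alg.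
exact: root_char_mulmat.
Qed.

Definition trQ x : rat := \tr (mulmat x).

Lemma alg_integer_trace x : alg_integer x -> trQ x \is a Num.int.
Proof.
move/char_poly_int/polyOverP/(_ (\dim {:K}).-1).
by rewrite char_poly_trace ?adim_gt0 // rpredN.
Qed.

End Integrality.

(** * Integral bases of lattices *)

Definition int_mx (m n : nat) (A : 'M[rat]_(m, n)) :=
  forall i j, A i j \is a Num.int.

Lemma int_mxE m n (A : 'M[rat]_(m, n)) :
  int_mx A -> exists B : 'M[int]_(m, n), A = map_mx intr B.
Proof.
by move=> iA; exists (map_mx numq A); apply/matrixP => i j; rewrite !mxE numqK.
Qed.

(** Cramer's rule: expanding along the replaced row gives its product with a
    column of the adjugate of W. *)
Lemma det_replace_row (F : fieldType) d (W : 'M[F]_d) (r : 'rV[F]_d) (i0 : 'I_d) :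
  W \in unitmx ->
  \det (\matrix_(i, j) if i == i0 then r 0 j else W i j)
    = \det W * (r *m invmx W) 0 i0.
Proof.
move=> uW; rewrite (expand_det_row _ i0) /invmx uW -scalemxAr [in RHS]mxE.
rewrite mulVKf; last by rewrite -unitfE -unitmxE.
rewrite mxE; apply: eq_bigr => j _; rewrite !mxE eqxx; congr (_ * (_ * \det _)).
by apply/matrixP => i k; rewrite !mxE eq_sym (negbTE (neq_lift _ _)).
Qed.

Section TraceForm.
Variable K : fieldExtType rat.
Implicit Types x y : K.
Notation vec := (vecof (vbasis {:K})).

Definition trace_form : 'M[rat]_(\dim {:K}) :=
  \matrix_(i, j) trQ ((vbasis {:K})`_i * (vbasis {:K})`_j).

Lemma trQD x y : trQ (x + y) = trQ x + trQ y.
Proof. by rewrite /trQ mulmatD linearD. Qed.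

Lemma trQZ a x : trQ (a *: x) = a * trQ x.
Proof. by rewrite /trQ mulmatZ linearZ. Qed.

Lemma trQ_sum (I : Type) (r : seq I) (P : pred I) (G : I -> K) :
  trQ (\sum_(i <- r | P i) G i) = \sum_(i <- r | P i) trQ (G i).
Proof.
elim/big_rec2: _ => [|i y x _ <-]; last by rewrite trQD.
by rewrite /trQ mulmat0 linear0.
Qed.

Lemma trace_formE (u w : 'rV[rat]_(\dim {:K})) :
  (u *m trace_form *m w^T) 0 0 = trQ (vec u * vec w).
Proof.
rewrite /vecof mulr_sumr trQ_sum mxE; apply: eq_bigr => j _.
rewrite mulr_suml trQ_sum !mxE mulr_suml; apply: eq_bigr => i _.
by rewrite ?mxE -scalerAl -scalerAr !trQZ mulrAC mulrA.
Qed.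

(** A vector in the radical would be a nonzero x with Tr(x y) = 0 for all y, but
    Tr(x x^-1) is the degree of K. *)
Lemma det_trace_form_neq0 : \det trace_form != 0.
Proof.
apply/det0P => -[v v0 vT]; have := trace_formE v (coords (vec v)^-1).
rewrite vT mul0mx mxE rVofK ?vbasisP // mulfV; last first.
  by rewrite vecof_eq0 ?vbasisP.
rewrite /trQ mulmat1 mxtrace1 => /esym/eqP; rewrite pnatr_eq0.
by rewrite gtn_eqF ?adim_gt0.
Qed.

(** The determinant of the matrix of traces of products of the rows of W, read
    as elements of K. *)
Definition disc (W : 'M[rat]_(\dim {:K})) : rat := \det W ^+ 2 * \det trace_form.

Lemma disc_int W : (forall i, alg_integer (vec (row i W))) -> disc W \is a Num.int.
Proof.
move=> iW; have -> : disc W = \det (W *m trace_form *m W^T).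
  by rewrite !det_mulmx det_tr /disc expr2 mulrAC.
have [|B ->] := @int_mxE _ _ (W *m trace_form *m W^T); last first.
  by rewrite det_map_mx intr_int.
move=> i j; have -> : (W *m trace_form *m W^T) i j =
    (row i W *m trace_form *m (row j W)^T) 0 0.
  by rewrite -row_mul !mxE; apply: eq_bigr => k _; rewrite !mxE.
by rewrite trace_formE; apply: alg_integer_trace; apply: integral_mul; apply: iW.
Qed.

End TraceForm.

Section Lattice.
Variables (K : fieldExtType rat) (L : {pred K}).
Hypotheses (LZ : zmod_closed L) (L_int : forall x, x \in L -> alg_integer x).
Hypothesis L_full : forall y, exists2 D : int, D != 0 & D%:~R * y \in L.
#[local] HB.instance Definition _ := GRing.isZmodClosed.Build K L LZ.
Notation vec := (vecof (vbasis {:K})).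

(** Among the rational bases contained in L, one of minimal discriminant
    generates L: if some y in L had a coordinate a that is not an integer,
    replacing the corresponding basis vector by y minus floor(a) times it would
    multiply the discriminant by (a - floor(a))^2 < 1.  The rows of W are the
    coordinates of the basis. *)
Lemma lattice_basis : exists W : 'M[rat]_(\dim {:K}),
  [/\ W \in unitmx, forall i, vec (row i W) \in L
    & forall y, y \in L -> int_mx (coords y *m invmx W)].
Proof.
pose good k := `[< exists W : 'M[rat]_(\dim {:K}),
  [/\ W \in unitmx, forall i, vec (row i W) \in L & `|disc W| = k%:R] >].
have good_disc W : W \in unitmx -> (forall i, vec (row i W) \in L) ->
    exists2 k, good k & `|disc W| = k%:R.
  move=> uW WL; have /intrP[c cE] : disc W \is a Num.int.
    by apply: disc_int => i; apply: L_int.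
  exists `|c|%N; last by rewrite cE -intr_norm -abszE.
  by apply/asboolP; exists W; split; rewrite // cE -intr_norm -abszE.
have exk : exists k, good k.
  pose D i := s2val (sig2_eqW (L_full (vec (row i 1%:M)))).
  have D0 i : D i != 0 by rewrite /D; case: sig2_eqW.
  have DL i : (D i)%:~R * vec (row i 1%:M) \in L by rewrite /D; case: sig2_eqW.
  have [|i|k gk _] := good_disc (diag_mx (\row_i (D i)%:~R)).
  - rewrite unitmxE det_diag unitfE; apply/prodf_neq0 => i _.
    by rewrite mxE intr_eq0.
  - have -> : row i (diag_mx (\row_i (D i)%:~R)) = (D i)%:~R *: row i 1%:M
        :> 'rV[rat]_(\dim {:K}).
      by apply/rowP => j; rewrite !mxE mulr_natr.
    by rewrite linearZ /= -mulr_algl -intr_alg.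
  - by exists k.
case: (ex_minnP exk) => k /asboolP[W [uW WL Wk]] kmin.
exists W; split=> // y yL i0 i; rewrite [i0]ord1 {i0}.
set a := coords y *m invmx W; pose c := Num.floor (a 0 i).
have [//|nai] := boolP (a 0 i \is a Num.int).
pose r := coords y - c%:~R *: row i W.
pose W' : 'M[rat]_(\dim {:K}) := \matrix_(i', j) if i' == i then r 0 j else W i' j.
have detW' : \det W' = \det W * (a 0 i - c%:~R).
  rewrite det_replace_row // /r mulmxBl -scalemxAl -row_mul mulmxV //.
  by rewrite !mxE eqxx mulr1.
have fr0 : a 0 i - c%:~R != 0.
  by apply: contra nai; rewrite subr_eq0 => /eqP ->; apply: intr_int.
have fr_ge0 : 0 <= a 0 i - c%:~R by rewrite subr_ge0 floor_le.
have fr_lt1 : a 0 i - c%:~R < 1.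
  by rewrite ltrBlDl -[1]/(1%:~R) -rmorphD /= floorD1_gt.
have W0 : \det W != 0 by rewrite -unitfE -unitmxE.
have [||k' gk' W'k] := good_disc W'.
- by rewrite unitmxE unitfE detW' mulf_neq0.
- move=> i'; have [->|ni] := eqVneq i' i.
    have -> : row i W' = r by apply/rowP => j; rewrite mxE /W' mxE eqxx.
    rewrite /r linearB linearZ /= rVofK ?vbasisP //.
    by rewrite rpredB // -mulr_algl -intr_alg mulrzl rpredMz.
  have -> : row i' W' = row i' W by apply/rowP => j; rewrite /W' !mxE (negbTE ni).
  exact: WL.
have := kmin _ gk'; rewrite -(ler_nat rat) -Wk -W'k leNgt => /negP[].
rewrite /disc detW' exprMn mulrAC normrM -[X in _ < X]mulr1.
rewrite ltr_pM2l ?normr_gt0 ?mulf_neq0 ?expf_neq0 ?det_trace_form_neq0 //.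
by rewrite ger0_norm ?exprn_ge0 // expr_lt1.
Qed.

End Lattice.

Lemma unit_int_mx_inv d (A : 'M[int]_d) : `|\det A|%N = 1%N ->
  exists B : 'M[int]_d, B *m A = 1%:M.
Proof.
move=> d1; exists (invmx A); rewrite mulVmx // unitmxE.
have : \det A = 1 \/ \det A = -1 by lia.
by case=> ->; rewrite ?unitrN1 ?unitr1.
Qed.

(** * Orders in the integers *)

Lemma ord_in_fin (F : fieldType) (S : {pred F}) (q x : F) (l : nat) :
  ord_in S q x = (l%:Z)%:E -> x != 0 /\ ordn S q x = l.
Proof. by rewrite ord_inE; case: eqVneq => // _ [->]. Qed.

(** A zero x has infinite order, but is divisible by every power of q, so that
    an exponent can be found in all cases. *)
Lemma ord_in_lower_bound (F : fieldType) (S : {pred F}) (q x : F) (a l n : nat) :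
  subring_closed S -> x \in S -> (0 < n)%N ->
  ((a%:Z)%:E * (l%:Z)%:E <= (n%:Z)%:E * ord_in S q x)%E ->
  exists2 k, dvd_in S (q ^+ k) x & (a * l <= n * k)%N.
Proof.
move=> SS xS n0; rewrite ord_inE; case: eqVneq => [->|x0] le_ord.
  exists (a * l)%N; first exact: dvd_in0.
  by rewrite leq_pmull.
exists (ordn S q x); first exact: dvd_in_ordn.
by move: le_ord; rewrite -!EFinM lee_fin.
Qed.

Lemma dvd_ZZ (p a : int) : dvd_in ZZ p%:~R a%:~R <-> (p %| a)%Z.
Proof.
split=> [[_ /intrP[c ->]]|/dvdzP[c ->]].
  by rewrite -intrM => /intr_inj ->; rewrite dvdz_mulr.
by exists c%:~R; rewrite ?inE ?intr_int // mulrC intrM.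
Qed.

Lemma Pr_ZZ_prime (p : int) : Pr ZZ p%:~R -> prime `|p|.
Proof.
case=> _ p0 nup pP; rewrite intr_eq0 in p0.
apply/primeP; split.
  rewrite ltn_neqAle lt0n absz_eq0 p0 andbT; apply/eqP => p1; apply: nup.
  exists p%:~R; first by rewrite inE intr_int.
  rewrite -intrM -expr2; suff -> : p ^+ 2 = 1 by [].
  by have [->|->] : p = 1 \/ p = -1 by lia.
move=> d /dvdnP[e pE]; rewrite pE.
have : dvd_in ZZ p%:~R (e%:Z%:~R * d%:Z%:~R).
  rewrite -intrM; apply/dvd_ZZ; rewrite -PoszM -pE; apply/dvdzP.
  by exists (Num.sg p); lia.
have p_gt0 : (0 < e * d)%N by rewrite -pE lt0n absz_eq0.
move: (p_gt0); rewrite muln_gt0 => /andP[e0 d0].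
case/(pP _ _ (intr_int _ _) (intr_int _ _))=> /dvd_ZZ;
  rewrite /dvdz /= pE => /dvdn_leq.
  by move/(_ e0); rewrite -{2}[e]muln1 leq_pmul2l // => ?; apply/orP; left; lia.
move/(_ d0); rewrite -{2}[d]mul1n leq_pmul2r // => ?; apply/orP; right; nia.
Qed.

Lemma ord_ZZ_eq0 (p a : int) : Pr ZZ p%:~R ->
  ord_in ZZ p%:~R a%:~R = 0%:E -> ~~ (p %| a)%Z.
Proof.
move=> Pp /(@ord_in_fin _ _ _ _ 0)[a0 oa]; have pp := Pr_ZZ_prime Pp.
apply/negP => /dvd_ZZ pa.
have fin x : x \in ZZ -> x != 0 -> exists k, ~ dvd_in ZZ (p%:~R ^+ k) x.
  case/intrP=> {oa pa}c -> c0; exists `|c|.+1%N.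
  rewrite -rmorphXn /= => /dvd_ZZ; rewrite /dvdz abszX => /dvdn_leq.
  rewrite lt0n absz_eq0 -(intr_eq0 rat) => /(_ c0); rewrite leqNgt => /negP; apply.
  by rewrite ltnW // ltn_expl // prime_gt1.
have := ordn_max fin _ a0; rewrite oa expr1; apply=> //.
by rewrite inE intr_int.
Qed.

(** * Prime elements of orders *)

Section Orders.
Variables (K : fieldExtType rat) (R : {pred K}) (R_order : order_of R).
Let RS : subring_closed R. Proof. by case: R_order. Qed.
#[local] HB.instance Definition _ := GRing.isSubringClosed.Build K R RS.
Let R_int x : x \in R -> alg_integer x.
Proof. by case: R_order => _ h _; apply: h. Qed.

Notation vec := (vecof (vbasis {:K})).

Lemma order_norm_int x : x \in R -> exists c : int, normQ x = c%:~R.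
Proof. by move/R_int/alg_integer_norm/intrP. Qed.

(** The characteristic polynomial of x has integer coefficients and constant
    term N(x) up to sign; evaluating it at x exhibits N(x) as x times a
    polynomial in x. *)
Lemma order_dvd_norm x : x \in R -> dvd_in R x (normQ x)%:A.
Proof.
move=> xR; have := root_char_mulmat x.
have := char_poly_det (mulmat x); rewrite -normQE.
have [g ->] := floorpP (char_poly_int (R_int xR)).
have -> : map_poly (in_alg K) (map_poly intr g) = map_poly intr g.
  by rewrite -map_poly_comp; apply: eq_map_poly => c /=; rewrite -intr_alg.
have /(congr1 (fun N => N%:A : K)) := signrMK (\dim {:K}) (normQ x).
elim/poly_ind: g => [|g c _].
  rewrite rmorph0 coef0 => + /esym N0; rewrite N0 mulr0 scale0r => <- _.
  by exists 0; rewrite ?rpred0 ?mulr0.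
rewrite !rmorphD !rmorphM /= !map_polyX !map_polyC /= coefD coefMX coefC add0r /=.
move=> <- <-; rewrite /root !hornerE addr_eq0 => /eqP gx.
have -> : ((-1) ^+ \dim {:K} * c%:~R)%:A = (-1) ^+ \dim {:K} * c%:~R :> K.
  by rewrite -[LHS]/(in_alg K _) rmorphM rmorph_sign rmorph_int.
exists (- ((-1) ^+ \dim {:K} * (map_poly intr g).[x])).
  rewrite rpredN rpredMsign; apply: rpred_horner => //.
  by apply/polyOverP => i; rewrite coef_map /= rpred_int.
by rewrite mulrN -[x * _]mulrC -mulrA gx mulrN opprK.
Qed.

Lemma order_normQ_unit x : x \in R -> `|normQ x| = 1 -> unit_in R x.
Proof.
move=> xR N1; have [z zR] := order_dvd_norm xR.
have [N0|N0] := ger0P (normQ x); move: N1; rewrite ?(ger0_norm N0) ?(ltr0_norm N0).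
  by move=> -> /=; rewrite scale1r => xz; exists z.
move/eqP; rewrite eqr_oppLR => /eqP ->; rewrite scaleN1r => e.
by exists (- z); rewrite ?rpredN // mulrN -e opprK.
Qed.

(** If q^k divides x, then N(q)^k divides the nonzero integer N(x), while
    |N(q)| > 1; k = |N(x)| + 1 is already too large. *)
Lemma order_finite q x : q \in R -> ~ unit_in R q -> x \in R -> x != 0 ->
  exists k, ~ dvd_in R (q ^+ k) x.
Proof.
move=> qR nuq xR x0; have [a aE] := order_norm_int xR.
have [c cE] := order_norm_int qR.
have c2 : c != 0 -> (1 < `|c|)%N.
  move=> c0; rewrite ltn_neqAle lt0n absz_eq0 c0 andbT; apply/eqP => c1.
  by apply: nuq; apply: order_normQ_unit; rewrite // cE -intr_norm -abszE -c1.
exists `|a|.+1%N => -[z zR xE]; have [b bE] := order_norm_int zR.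
have a0 : a != 0 by rewrite -(intr_eq0 rat) -aE normQ_eq0.
have : (a = c ^+ `|a|.+1 * b)%R.
  by apply: (@intr_inj rat); rewrite rmorphM rmorphXn /= -aE -bE -cE xE normQM normQX.
move/(congr1 absz); rewrite abszM abszX => e.
have b0 : (0 < `|b|)%N.
  by rewrite lt0n; apply: contra a0 => /eqP b0; rewrite -absz_eq0 e b0 muln0.
have c0 : c != 0.
  by apply: contra a0 => /eqP c0; rewrite -absz_eq0 e c0 exp0n.
have := ltn_expl `|a|.+1 (c2 c0); rewrite ltnNge => /negP; apply.
by rewrite ltnW // ltnS [X in (_ <= X)%N]e leq_pmulr.
Qed.

(** Some multiple D y is an algebraic integer.  Two of the elements k D y fall
    into the same coset of R, and their difference is a multiple of y in R. *)
Lemma order_multiple y : exists2 D : int, D != 0 & D%:~R * y \in R.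
Proof.
have [D D0 Dy] := alg_integer_multiple y.
have [_ _ [s cover]] := R_order.
have mult_int k : alg_integer (k%:R * (D%:~R * y)).
  by apply: integral_mul => //; apply: integral_nat.
pose c k := s2val (sig2_eqW (cover _ (mult_int k))).
have cs k : c k \in s by rewrite /c; case: sig2_eqW.
have cR k : k%:R * (D%:~R * y) - c k \in R by rewrite /c; case: sig2_eqW.
have : ~~ uniq [seq c k | k <- iota 0 (size s).+1].
  apply/negP => u.
  have : (size [seq c k | k <- iota 0 (size s).+1] <= size s)%N.
    by apply: uniq_leq_size => // _ /mapP[k _ ->].
  by rewrite size_map size_iota ltnn.
move/(uniqPn 0) => [i [j [ltij]]]; rewrite size_map size_iota => ltj.
rewrite !(nth_map 0%N) ?size_iota ?(ltn_trans ltij) // !nth_iota ?(ltn_trans ltij) //.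
rewrite !add0n => cij; exists ((j - i)%N%:Z * D).
  by rewrite mulf_neq0 // eqz_nat subn_eq0 -ltnNge.
have := rpredB (cR j) (cR i); rewrite cij opprB addrA subrK -mulrBl.
by rewrite intrM mulrA -natrB ?(ltnW ltij).
Qed.

(** No subgroup lies strictly between q R and R when N(q) is prime.  With A and
    B the integral matrices expressing a basis of M in one of R, and a basis of
    q R in one of M, N(q) = det B det A, so that A or B is invertible over the
    integers. *)
Lemma prime_norm_index (q : K) (p : int) (M : {pred K}) :
    q \in R -> normQ q = p%:~R -> prime `|p| -> zmod_closed M ->
    {subset M <= R} -> (forall x, x \in R -> q * x \in M) ->
  {subset R <= M} \/ (forall x, x \in M -> dvd_in R q x).
Proof.
move=> qR Nq pp MZ MR qM.
have q0 : q != 0.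
  by rewrite -normQ_eq0 Nq intr_eq0; case: p pp {Nq} => [[]|].
have RZ : zmod_closed R by apply: GRing.subring_closedB.
have [W [uW WR RW]] := lattice_basis RZ R_int order_multiple.
have [|y|V [uV VM MV]] := lattice_basis MZ.
- by move=> x /MR /R_int.
- have [D D0 Dy] := order_multiple (q^-1 * y); exists D => //.
  by have := qM _ Dy; rewrite mulrCA mulVKf.
have [A AE] : exists A : 'M[int]_(\dim {:K}), V = map_mx intr A *m W.
  have [|A AE] := @int_mxE _ _ (V *m invmx W).
    move=> i j; have := RW _ (MR _ (VM i)) 0 j.
    by rewrite vecofK ?vbasisP // -row_mul mxE.
  by exists A; rewrite -AE mulmxKV.
have [B BE] : exists B : 'M[int]_(\dim {:K}), W *m mulmat q = map_mx intr B *m V.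
  have [|B BE] := @int_mxE _ _ (W *m mulmat q *m invmx V).
    move=> i j; have := MV _ (qM _ (WR i)) 0 j.
    by rewrite coordsM vecofK ?vbasisP // -!row_mul mxE.
  by exists B; rewrite -BE mulmxKV.
have pE : p = \det B * \det A.
  apply: (@intr_inj rat); rewrite -Nq normQE.
  have := congr1 determinant BE; rewrite AE !det_mulmx mulrC mulrA => /mulIf ->.
    by rewrite !det_map_mx -rmorphM.
  by rewrite -unitfE -unitmxE.
(* A subgroup contains the integral combinations of its elements. *)
have int_comb (N : {pred K}) (NZ : zmod_closed N) (U : 'M[rat]_(\dim {:K})) a :
    int_mx a -> (forall i, vec (row i U) \in N) -> vec (a *m U) \in N.
  pose N' : zmodClosed K := HB.pack N (GRing.isZmodClosed.Build K N NZ).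
  rewrite -[N]/(N' : {pred K}) => ia UN; rewrite mulmx_sum_row linear_sum.
  apply: rpred_sum => j _; rewrite linearZ /=; have /intrP[c ->] := ia 0 j.
  rewrite -mulr_algl -intr_alg mulrzl -[N]/(N' : {pred K}).
  by apply: rpredMz; apply: UN.
have /orP[/eqP dA|/eqP dB] : ((`|\det A| == 1) || (`|\det B| == 1))%N.
  move: pp; rewrite pE abszM => /primeP[gt1 /(_ `|\det A|%N)].
  rewrite dvdn_mull // => /(_ isT)/orP[A1|dd].
    by apply/orP; left.
  have A0 : (0 < `|\det A|)%N by case: `|\det A|%N gt1 => //; rewrite muln0.
  apply/orP; right; move/eqP: dd; rewrite -{1}[`|\det A|%N]mul1n => /eqP.
  by rewrite eqn_pmul2r // eq_sym.
- left=> x xR; have [C CA] := unit_int_mx_inv dA.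
  have WM i : vec (row i W) \in M.
    have -> : W = map_mx intr C *m V.
      by rewrite AE mulmxA -map_mxM CA map_mx1 mul1mx.
    rewrite row_mul; apply: int_comb => //.
    by move=> k l; rewrite !mxE intr_int.
  rewrite -[x](rVofK (vbasisP _)) -(mulmxKV uW (coords x)).
  by apply: int_comb => //; apply: RW.
- right=> x xM; have [C CB] := unit_int_mx_inv dB.
  pose N : {pred K} := [pred x | x / q \in R].
  have NZ : zmod_closed N.
    split=> [|y z]; rewrite !inE ?mul0r ?rpred0 // mulrBl => *.
    exact: rpredB.
  have WN i : vec (row i (W *m mulmat q)) \in N.
    rewrite row_mul -[row i W](vecofK (vbasisP _)) -coordsM rVofK ?vbasisP //.
    by rewrite inE mulrAC mulfV // mul1r; apply: WR.
  have VN i : vec (row i V) \in N.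
    have -> : V = map_mx intr C *m (W *m mulmat q).
      by rewrite BE mulmxA -map_mxM CB map_mx1 mul1mx.
    rewrite row_mul; apply: int_comb => //.
    by move=> k l; rewrite !mxE intr_int.
  have : x \in N.
    rewrite -[x](rVofK (vbasisP _)) -(mulmxKV uV (coords x)).
    by apply: int_comb => //; apply: MV.
  by rewrite inE => xqR; exists (x / q); rewrite // mulrCA mulfV // mulr1.
Qed.

(** The ideal q R is maximal: if q does not divide x, then x R + q R is all of
    R and contains 1, and multiplying by y gives y in x y R + q R. *)
Lemma prime_norm_Pr (q : K) (p : int) :
  q \in R -> normQ q = p%:~R -> prime `|p| -> Pr R q.
Proof.
move=> qR Nq pp.
have q0 : q != 0.
  by rewrite -normQ_eq0 Nq intr_eq0; case: p pp {Nq} => [[]|].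
split=> //.
  case=> y yR qy; have [c cE] := order_norm_int yR.
  have := congr1 (@normQ K) qy; rewrite normQM normQ1 Nq cE -rmorphM /=.
  move=> /(@intr_inj rat _ 1)/(congr1 absz); rewrite abszM => /eqP.
  by rewrite muln_eq1 => /andP[/eqP p1]; rewrite p1 in pp.
move=> x y xR yR [z zR xyE]; have [qx|nqx] := pselect (dvd_in R q x); [by left|right].
pose M : {pred K} := [pred t |
  `[< exists a b, [/\ a \in R, b \in R & t = x * a + q * b] >]].
have MZ : zmod_closed M.
  split; first by apply/asboolP; exists 0, 0; rewrite rpred0 !mulr0 addr0.
  move=> _ _ /asboolP[a [b [aR bR ->]]] /asboolP[c [d [cR dR ->]]].
  apply/asboolP; exists (a - c), (b - d); rewrite !rpredB //; split=> //.
  by rewrite opprD addrACA -!mulrBr.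
have [|t tR|RM|Mq] := prime_norm_index qR Nq pp MZ.
- by move=> _ /asboolP[a [b [aR bR ->]]]; rewrite rpredD ?rpredM.
- by apply/asboolP; exists 0, t; rewrite rpred0 mulr0 add0r.
- have /asboolP[a [b [aR bR e]]] := RM 1 (rpred1 _).
  exists (z * a + b * y); first by rewrite rpredD ?rpredM.
  by rewrite -[LHS]mul1r e mulrDl mulrAC xyE mulrDr !mulrA.
- case: nqx; apply: Mq; apply/asboolP; exists 1, 0.
  by rewrite rpred1 rpred0 mulr1 mulr0 addr0.
Qed.

Lemma order_dumas (f : {poly K}) (n l : nat) (q : K) :
    f \is a polyOver R -> size f = n.+1 -> Pr R q ->
    ~ dvd_in R q f`_n ->
    dvd_in R (q ^+ l) f`_0 -> ~ dvd_in R (q ^+ l.+1) f`_0 ->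
    coprime n l ->
    (forall j, (0 < j < n)%N ->
       exists2 k, dvd_in R (q ^+ k) f`_j & ((n - j) * l <= n * k)%N) ->
  irreducible_over R f.
Proof.
move=> fR sf Prq; have [qR q0 nuq _] := Prq.
apply: dumas_irreducible => // x xR x0; exact: (order_finite qR nuq).
Qed.

Lemma prime_order_criterion (f : {poly K}) (n l : nat) (q : K) :
    f \is a polyOver R -> size f = n.+1 -> Pr R q ->
    ord_in R q f`_n = 0%:E ->
    ord_in R q f`_0 = (l%:Z)%:E ->
    coprime n l ->
    (forall j : nat, (0 < j < n)%N ->
       (((n - j)%N%:Z)%:E * ord_in R q f`_0 <= (n%:Z)%:E * ord_in R q f`_j)%E) ->
  irreducible_over R f.
Proof.
move=> fR sf Prq ofn of0 co_nl Hj; have [qR q0 nuq _] := Prq.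
have /polyOverP fRi := fR.
have fin x : x \in R -> x != 0 -> exists k, ~ dvd_in R (q ^+ k) x.
  exact: (order_finite qR nuq).
have [fn0 on] := @ord_in_fin _ _ _ _ 0 ofn; have [f00 o0] := ord_in_fin of0.
apply: (order_dumas (l := l) fR sf Prq) => //.
- by have := ordn_max fin (fRi n) fn0; rewrite on expr1.
- by rewrite -o0; apply: dvd_in_ordn.
- by have := ordn_max fin (fRi 0%N) f00; rewrite o0.
move=> j /andP[j0 jn]; apply: ord_in_lower_bound => //.
  exact: leq_trans j0 (ltnW jn).
by rewrite -of0; apply: Hj; rewrite j0.
Qed.

Lemma not_dvd_in_normQ (q x : K) (p c : int) :
  q \in R -> normQ q = p%:~R -> normQ x = c%:~R -> ~~ (p %| c)%Z ->
  ~ dvd_in R q x.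
Proof.
move=> qR Nq Nx npc [z zR xE]; case/negP: npc.
have [d dE] := order_norm_int zR.
move: Nx; rewrite xE normQM Nq dE -rmorphM /= => /intr_inj <-.
by rewrite dvdz_mulr.
Qed.

(** With p = q^e u as in the statement, the q-order of c_0 = p^l w is e l: q
    divides neither u nor w, the latter because p does not divide N(w). *)
Lemma rational_prime_criterion (f : {poly K}) (n l e : nat) (q u : K) (p : int) :
    f \is a polyOver R -> size f = n.+1 ->
    Pr ZZ p%:~R -> Pr R q -> normQ q = p%:~R ->
    u \in R -> p%:~R = q ^+ e * u -> ~ dvd_in R q u -> coprime n e ->
    ord_in R p%:~R f`_0 = (l%:Z)%:E ->
    ord_in ZZ p%:~R (normQ f`_n) = 0%:E ->
    ord_in ZZ p%:~R (normQ (f`_0 / p%:~R ^+ l)) = 0%:E ->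
    coprime n l ->
    (forall j : nat, (0 < j < n)%N ->
       (((n - j)%N%:Z)%:E * (l%:Z)%:E <= (n%:Z)%:E * ord_in R p%:~R f`_j)%E) ->
  irreducible_over R f.
Proof.
move=> fR sf Prp Prq Nq uR pE nqu co_ne of0 ofn of0l co_nl Hj.
have [qR q0 nuq q_euclid] := Prq; have /polyOverP fRi := fR.
have nq x : x \in R -> ord_in ZZ p%:~R (normQ x) = 0%:E -> ~ dvd_in R q x.
  move=> xR ox; have [c cE] := order_norm_int xR.
  apply: (not_dvd_in_normQ qR Nq cE); apply: ord_ZZ_eq0 => //.
  by rewrite -cE.
have p0 : (p%:~R : K) != 0.
  by have [_ p0 _ _] := Prp; rewrite intr_alg_eq0 -(intr_eq0 rat).
have dpq k : dvd_in R (q ^+ (e * k)) (p%:~R ^+ k).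
  by rewrite pE exprMn -exprM; apply: dvd_in_mulr; rewrite rpredX.
have [w wR f0E] : dvd_in R (p%:~R ^+ l) f`_0.
  have [_ <-] := ord_in_fin of0; exact: dvd_in_ordn.
have nqw : ~ dvd_in R q w.
  by apply: nq => //; move: of0l; rewrite f0E [_ * w]mulrC mulfK // expf_neq0.
have nqul : ~ dvd_in R q (u ^+ l * w).
  elim: l {Hj co_nl of0l of0 f0E} => [|l IH]; first by rewrite mul1r.
  rewrite exprS -mulrA => /q_euclid[] //.
  by rewrite rpredM // rpredX.
have f0q : f`_0 = q ^+ (e * l) * (u ^+ l * w).
  by rewrite f0E pE exprMn exprM mulrA.
have ulwR : u ^+ l * w \in R by rewrite rpredM ?rpredX.
apply: (order_dumas (l := (e * l)%N) fR sf Prq).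
- exact: nq.
- by rewrite f0q; apply: dvd_in_mulr.
- by rewrite f0q; apply: not_dvd_in_mul_exp.
- by rewrite coprimeMr co_ne.
move=> j jn; have n_gt0 : (0 < n)%N by case/andP: jn => j0 /ltnW; apply: leq_trans.
have [k dk lek] := ord_in_lower_bound RS (fRi j) n_gt0 (Hj j jn).
exists (e * k)%N; first exact: dvd_in_trans dk.
by rewrite mulnCA [(n * _)%N]mulnCA leq_mul2l lek orbT.
Qed.

End Orders.

(** * The pure cubic case *)

Section Cubic.
Variables (K : fieldExtType rat) (R : {pred K}) (delta : int) (alpha : K).
Hypotheses (alpha3 : alpha ^+ 3 = delta%:~R)
  (alpha_deg : \dim <<1; alpha>> = 3%N) (R_def : is_Zadjoin alpha R).

Definition cubic_elt (a b c : int) : K :=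
  a%:~R + b%:~R * alpha + c%:~R * alpha ^+ 2.

Lemma cubic_elt_in a b c : cubic_elt a b c \in R.
Proof.
apply/R_def; exists (a%:P + b%:P * 'X + c%:P * 'X^2).
rewrite !rmorphD !rmorphM /= !map_polyC /= !map_polyX !hornerE /=.
by rewrite /cubic_elt expr2 mulrA.
Qed.

Lemma cubic_eltM a b c a' b' c' :
  cubic_elt a b c * cubic_elt a' b' c' =
  cubic_elt (a * a' + delta * (b * c' + c * b'))
            (a * b' + b * a' + delta * (c * c'))
            (a * c' + b * b' + c * a').
Proof.
by rewrite /cubic_elt !(intrD, intrM) -alpha3; ring.
Qed.

Lemma in_cubic_elt x : x \in R -> exists a b c, x = cubic_elt a b c.
Proof.
case/R_def => g ->; elim/poly_ind: g => [|g d [a [b [c IH]]]].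
  by exists 0, 0, 0; rewrite rmorph0 horner0 /cubic_elt !mul0r !addr0.
exists (delta * c + d), a, b.
rewrite rmorphD rmorphM /= map_polyX map_polyC /= !hornerE IH.
by rewrite /cubic_elt !(intrD, intrM) -alpha3; ring.
Qed.

Lemma cubic_elt_inj a b c a' b' c' :
  cubic_elt a b c = cubic_elt a' b' c' -> [/\ a = a', b = b' & c = c'].
Proof.
move=> e; pose s : seq K := [:: (a - a')%:~R; (b - b')%:~R; (c - c')%:~R].
have pz : root (Poly s) alpha.
  have e0 : cubic_elt a b c - cubic_elt a' b' c' = 0 by rewrite e subrr.
  rewrite /root /= !horner_cons horner0; apply/eqP.
  by rewrite -[RHS]e0 /cubic_elt !rmorphB /=; ring.
have deg : adjoin_degree 1%AS alpha = 3%N.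
  by rewrite adjoin_degreeE alpha_deg dimv1 divn1.
have P0 : Poly s == 0.
  rewrite -(@root_small_adjoin_poly _ _ 1%AS alpha) //.
    by apply/polyOverP => i; rewrite coef_Poly; case: i => [|[|[|[|i]]]] /=;
      rewrite ?mem0v // intr_alg; apply: memvZ; apply: mem1v.
  by rewrite deg; apply: leq_trans (size_Poly _) _.
have z i : s`_i = 0 by rewrite -coef_Poly (eqP P0) coef0.
have inj (m m' : int) : (m - m')%:~R = 0 :> K -> m = m'.
  by move/eqP; rewrite intr_alg_eq0 subr_eq0 => /eqP.
by split; apply: inj; [exact: (z 0%N)|exact: (z 1%N)|exact: (z 2%N)].
Qed.

Lemma Euclid_dvdz (p a b : int) :
  prime `|p| -> (p %| a * b)%Z -> (p %| a)%Z || (p %| b)%Z.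
Proof. by move=> pp; rewrite !dvdzE abszM Euclid_dvdM. Qed.

(** The ring R / p R is reduced.  If z has coordinates a, b, c, the coordinates
    of z^2 give, modulo p,
      a^2 = - 2 delta b c,   delta c^2 = - 2 a b,   b^2 = - 2 a c.
    Multiplying these, delta (a b c)^2 = - 8 delta (a b c)^2, so that p divides
    9 delta (a b c)^2, hence one of a, b, c; the same congruences then show that
    it divides all three. *)
Lemma cubic_reduced_mod (p : int) z s :
  prime `|p| -> ~~ (p %| 3)%Z -> ~~ (p %| delta)%Z ->
  z \in R -> s \in R -> z ^+ 2 = p%:~R * s -> dvd_in R p%:~R z.
Proof.
move=> pp np3 npd /in_cubic_elt[a [b [c ->]]] /in_cubic_elt[s0 [s1 [s2 ->]]].
rewrite expr2 cubic_eltM.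
have -> : p%:~R * cubic_elt s0 s1 s2 = cubic_elt (p * s0) (p * s1) (p * s2).
  by rewrite /cubic_elt !intrM; ring.
case/cubic_elt_inj => e0 e1 e2.
have sq x : (p %| x * x)%Z -> (p %| x)%Z by case/(Euclid_dvdz pp)/orP.
have nd x : (p %| delta * x)%Z -> (p %| x)%Z.
  by case/(Euclid_dvdz pp)/orP => // pd; rewrite pd in npd.
have n3 x : (p %| 3 * x)%Z -> (p %| x)%Z.
  by case/(Euclid_dvdz pp)/orP => // pd; rewrite pd in np3.
have abc : (p %| a * (b * c))%Z.
  apply: (sq); do 2 apply: (n3); apply: (nd); apply/dvdzP.
  (* The product of the right-hand sides of E0, E1 and E2 below, plus
     8 delta (a b c)^2, is a multiple of p, with this quotient. *)
  exists (p * p * s0 * s1 * s2 - p * s0 * s2 * (2 * a * b)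
    - p * s0 * s1 * (2 * a * c) + s0 * (2 * a * b) * (2 * a * c)
    - p * s1 * s2 * (2 * delta * b * c) + s2 * (2 * delta * b * c) * (2 * a * b)
    + s1 * (2 * delta * b * c) * (2 * a * c)).
  have E0 : a * a = p * s0 - 2 * delta * b * c by rewrite -e0; ring.
  have E1 : delta * (c * c) = p * s1 - 2 * a * b by rewrite -e1; ring.
  have E2 : b * b = p * s2 - 2 * a * c by rewrite -e2; ring.
  transitivity (a * a * (b * b) * (delta * (c * c))
    + 8 * delta * (a * a * (b * b) * (c * c))); first by ring.
  by rewrite {1}E0 {1}E1 {1}E2; ring.
have pps x y : p * x = y -> (p %| y)%Z by move=> <-; apply: dvdz_mulr.
have d0 : (p %| a * a + 2 * delta * b * c)%Z.
  by apply: (pps s0); rewrite -e0; ring.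
have d1 : (p %| delta * (c * c) + 2 * a * b)%Z.
  by apply: (pps s1); rewrite -e1; ring.
have d2 : (p %| b * b + 2 * a * c)%Z.
  by apply: (pps s2); rewrite -e2; ring.
have [pa [pb pc]] : (p %| a)%Z /\ (p %| b)%Z /\ (p %| c)%Z.
  have bc_a : (p %| b)%Z \/ (p %| c)%Z -> (p %| a)%Z.
    move=> h; apply: sq; move: d0; rewrite rpredDr //.
    by case: h => h; [rewrite mulrAC|]; apply: dvdz_mull.
  have a_bc : (p %| a)%Z -> (p %| b)%Z /\ (p %| c)%Z.
    move=> pa; split.
      by apply: sq; move: d2; rewrite rpredDr // mulrAC dvdz_mull.
    by apply: sq; apply: nd; move: d1; rewrite rpredDr // mulrAC dvdz_mull.
  have pa : (p %| a)%Z.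
    case/(Euclid_dvdz pp)/orP: abc => // /(Euclid_dvdz pp)/orP h.
    exact: bc_a h.
  by split; last exact: a_bc.
move/dvdzP: pa => [a' ->]; move/dvdzP: pb => [b' ->]; move/dvdzP: pc => [c' ->].
exists (cubic_elt a' b' c'); first exact: cubic_elt_in.
by rewrite /cubic_elt !intrM; ring.
Qed.

(** If q divides the cofactor z = q t of p = q z, then z^2 = p t, so that p
    divides z by [cubic_reduced_mod], and p = q z makes q a unit. *)
Lemma cubic_unramified (p : int) (q : K) : order_of R ->
  Pr ZZ p%:~R -> p <> 3 -> p <> -3 -> gcdz p delta = 1 ->
  Pr R q -> normQ q = p%:~R ->
  exists z, [/\ z \in R, p%:~R = q ^+ 1 * z & ~ dvd_in R q z].
Proof.
move=> R_order Prp np3 npm3 co_pd [qR q0 nuq _] Nq.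
have pp := Pr_ZZ_prime Prp.
have [z zR] := order_dvd_norm R_order qR; rewrite Nq -intr_alg => pE.
exists z; split=> // -[t tR zE].
have p0 : (p%:~R : K) != 0.
  by have [_ p0 _ _] := Prp; rewrite intr_alg_eq0 -(intr_eq0 rat).
have np3' : ~~ (p %| 3)%Z.
  by apply/negP; rewrite dvdzE /= dvdn_prime2 // => /eqP p3; lia.
have npd : ~~ (p %| delta)%Z.
  apply/negP => pd; have : (p %| gcdz p delta)%Z by rewrite dvdz_gcd dvdzz.
  by rewrite co_pd dvdzE dvdn1 => /eqP p1; rewrite p1 in pp.
have [|r rR zr] := @cubic_reduced_mod p z t pp np3' npd zR tR.
  by rewrite pE zE; ring.
apply: nuq; exists r => //; apply: (mulfI p0).
by rewrite mulr1 {2}pE zr; ring.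
Qed.

End Cubic.

(** * Ramification in normal fields *)

(** The automorphism conjugates multiplication by x into multiplication by
    s x. *)
Lemma normQ_aut (K : fieldExtType rat) (s : 'AEnd(K)) (x : K) :
  normQ (s x) = normQ x.
Proof.
pose S := mxof (vbasis {:K}) (vbasis {:K}) s.
have SE y : coords (s y) = coords y *m S by rewrite -(rVof_app _ (vbasisP _)).
have S0 : \det S != 0.
  apply/det0P => -[v v0 vS]; have := SE (vecof (vbasis {:K}) v).
  rewrite vecofK ?vbasisP // vS => /eqP; rewrite rVof_eq0 ?vbasisP //.
  by rewrite fmorph_eq0 vecof_eq0 ?vbasisP // (negbTE v0).
have conj : S *m mulmat (s x) = mulmat x *m S.
  apply/row_matrixP => i; rewrite !row_mul row_mulmat -SE rmorphM coordsM SE.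
  by rewrite rVofE ?vbasisP // -rowE.
apply: (mulIf S0); rewrite !normQE -[RHS]det_mulmx -conj det_mulmx.
exact: mulrC.
Qed.

Lemma galois_rat (L : splittingFieldType rat) : galois 1 {:L}.
Proof.
rewrite /galois sub1v normalFieldf andbT; apply/separableP => y _.
by apply: pcharf0_separable => p; rewrite pchar_lalg pchar_num.
Qed.

Section GaloisRamification.
Variables (L : splittingFieldType rat) (R : {pred L}) (R_order : order_of R).
Let RS : subring_closed R. Proof. by case: R_order. Qed.
#[local] HB.instance Definition _ := GRing.isSubringClosed.Build L R RS.

(** The exponent e is the order of the subgroup H of automorphisms s such that q
    divides s q.  For s in H the quotient s q / q has norm 1, so that it is not
    divisible by q; hence q has order e in the product of the conjugates, which
    is rational of norm p^m and therefore p or - p. *)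
Lemma galois_ramification (q : L) (p : int) :
  Galois_invariant R -> q \in R -> normQ q = p%:~R ->
  prime `|p| -> Pr R q ->
  exists e u, [/\ (e %| \dim {:L})%N, u \in R, ~ dvd_in R q u
                & p%:~R = q ^+ e * u].
Proof.
move=> R_inv qR Nq pp [_ q0 _ q_euclid].
have sR (s : gal_of {:L}) x : s \in 'Gal({:L} / 1)%g -> x \in R -> s x \in R.
  rewrite gal_kAut ?sub1v // => /R_inv inv xR; apply/inv.
  by exists x.
have Ns (s : gal_of {:L}) x : normQ (s x) = normQ x by apply: normQ_aut.
pose H := [set s in 'Gal({:L} / 1)%g | `[< dvd_in R q (s q) >]].
have gH : group_set H.
  apply/group_setP; split.
    rewrite inE group1 /=; apply/asboolP; rewrite gal_id.
    by exists 1; rewrite ?mulr1 //; apply: rpred1.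
  move=> s t; rewrite !inE.
  move=> /andP[Gs /asboolP[z zR sq]] /andP[Gt /asboolP[w wR tq]].
  rewrite groupM //=; apply/asboolP; rewrite galM ?memvf // sq rmorphM /= tq.
  exists (w * t z); last by rewrite mulrA.
  by rewrite rpredM // sR.
(* The part of s q that is prime to q. *)
pose t (s : gal_of {:L}) := if s \in H then s q / q else s q.
have norm1 x : normQ x = 1 -> ~ dvd_in R q x.
  move=> Nx; apply: (not_dvd_in_normQ (c := 1) R_order qR Nq) => //.
  by rewrite dvdzE dvdn1; apply/eqP => p1; rewrite p1 in pp.
have tE (s : gal_of {:L}) : s q = q ^+ (s \in H) * t s.
  by rewrite /t; case: ifP => _; rewrite ?mul1r // expr1 mulrCA mulfV ?mulr1.
have tR (s : gal_of {:L}) : s \in 'Gal({:L} / 1)%g -> t s \in R.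
  move=> Gs; rewrite /t; case: ifP => [|_]; last exact: sR.
  by rewrite inE => /andP[_ /asboolP[z zR ->]]; rewrite mulrAC mulfV ?mul1r.
have nqt (s : gal_of {:L}) : s \in 'Gal({:L} / 1)%g -> ~ dvd_in R q (t s).
  move=> Gs; rewrite /t; case: ifP => [_|]; last by rewrite inE Gs => /asboolP.
  by apply: norm1; rewrite normQM Ns -normQM mulfV ?normQ1.
pose u := \prod_(s in 'Gal({:L} / 1)%g) t s.
have uR : u \in R by apply: rpred_prod.
have nqu : ~ dvd_in R q u.
  suff [] : u \in R /\ ~ dvd_in R q u by [].
  rewrite /u; elim/big_rec: _ => [|s x Gs [xR nqx]].
    by split; [exact: rpred1 | apply: norm1; rewrite normQ1].
  split; first by rewrite rpredM // tR.
  by case/(q_euclid _ _ (tR s Gs) xR) => //; apply: nqt.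
have PE : galNorm 1 {:L} q = q ^+ #|H| * u.
  rewrite /galNorm (eq_bigr _ (fun s _ => tE s)) big_split /=; congr (_ * _).
  rewrite prodrXr -sum1_card [in RHS]big_mkcond [in LHS]big_mkcond /=.
  congr (_ ^+ _).
  by apply: eq_bigr => s _; rewrite !inE; case: (s \in _) => //=; case: asboolP.
have [r rE] : exists r, galNorm 1 {:L} q = r%:A.
  by apply/vlineP; apply: mem_galNorm; rewrite ?galois_rat ?memvf.
have cardG : #|'Gal({:L} / 1)%g| = \dim {:L}.
  by rewrite -(galois_dim (galois_rat L)) dimv1 divn1.
have rp : r = p%:~R \/ r = - p%:~R.
  have : normQ (galNorm 1 {:L} q) = p%:~R ^+ \dim {:L}.
    rewrite /galNorm (big_morph _ (@normQM L) (@normQ1 L)).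
    by rewrite (eq_bigr (fun=> p%:~R)) ?prodr_const ?cardG // => s _; rewrite Ns.
  rewrite rE normQ_scalar => /(congr1 Num.norm); rewrite !normrX => /eqP.
  rewrite eqrXn2 ?adim_gt0 // eqr_norm2 => /orP[]/eqP; by [left|right].
have dvdH : (#|H| %| \dim {:L})%N.
  rewrite -cardG; apply: (@cardSg _ (galoisG_group {:L} 1) (Group gH)).
  by apply/fintype.subsetP => s; rewrite inE => /andP[].
case: rp => rp.
  by exists #|H|, u; split; rewrite // -PE rE rp -intr_alg.
exists #|H|, (- u); split=> //; first by rewrite rpredN.
  by case=> z zR uE; apply: nqu; exists (- z); rewrite ?rpredN // mulrN -uE opprK.
by rewrite mulrN -PE rE rp scaleNr opprK -intr_alg.
Qed.

End GaloisRamification.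

(** * The three criteria *)

Theorem theorem0p5 (K : fieldExtType rat) (R : {pred K}) (f : {poly K})
    (n : nat) (R_order : order_of R) (f_R : f \is a polyOver R)
    (deg_f : size f = n.+1) (n_le6 : (n <= 6)%N) :
  [/\ (* (i) *)
      forall (q : K) (l : nat),
        Pr R q ->
        ord_in R q f`_n = 0%:E ->
        ord_in R q f`_0 = (l%:Z)%:E ->
        coprime n l ->
        (forall j : nat, (0 < j < n)%N ->
           (((n - j)%N%:Z)%:E * ord_in R q f`_0
              <= (n%:Z)%:E * ord_in R q f`_j)%E) ->
        irreducible_over R f,
      (* (ii) *)
      forall (m : nat) (p : int) (l : nat),
        normal_field K ->
        \dim {:K} = m ->
        Galois_invariant R ->
        Pr ZZ p%:~R ->
        (exists2 q : K, q \in R & normQ q = p%:~R) ->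
        coprime n m ->
        ord_in R p%:~R f`_0 = (l%:Z)%:E ->
        ord_in ZZ p%:~R (normQ f`_n) = 0%:E ->
        ord_in ZZ p%:~R (normQ (f`_0 / p%:~R ^+ l)) = 0%:E ->
        coprime n l ->
        (forall j : nat, (0 < j < n)%N ->
           (((n - j)%N%:Z)%:E * (l%:Z)%:E
              <= (n%:Z)%:E * ord_in R p%:~R f`_j)%E) ->
        irreducible_over R f
    & (* (iii) *)
      forall (delta : int) (alpha : K) (p : int) (a b c : int) (l : nat),
        cube_free delta ->
        real_cube_root delta alpha ->
        <<1; alpha>>%VS = {:K}%VS ->
        \dim <<1; alpha>> = 3%N ->
        is_Zadjoin alpha R ->
        Pr ZZ p%:~R ->
        p <> 3 -> p <> -3 ->
        gcdz p delta = 1 ->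
        let q := a%:~R + b%:~R * alpha + c%:~R * alpha ^+ 2 in
        Pr R q ->
        normQ q = p%:~R ->
        ~~ (p %| a * b - c ^+ 2 * delta)%Z \/ ~~ (p %| a * c - b ^+ 2)%Z ->
        ord_in R p%:~R f`_0 = (l%:Z)%:E ->
        ord_in ZZ p%:~R (normQ f`_n) = 0%:E ->
        ord_in ZZ p%:~R (normQ (f`_0 / p%:~R ^+ l)) = 0%:E ->
        coprime n l ->
        (forall j : nat, (0 < j < n)%N ->
           (((n - j)%N%:Z)%:E * (l%:Z)%:E
              <= (n%:Z)%:E * ord_in R p%:~R f`_j)%E) ->
        irreducible_over R f].
Proof.
split.
- move=> q l Prq ofn of0 co_nl Hj.
  exact: (prime_order_criterion R_order f_R deg_f Prq ofn of0).
- move=> m p l K_normal dimK R_inv Prp [q qR Nq] co_nm.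
  pose L : splittingFieldType rat :=
    HB.pack K (FieldExt_isSplittingField.Build rat K K_normal).
  have pp := Pr_ZZ_prime Prp.
  have Prq := prime_norm_Pr R_order qR Nq pp.
  have [e [u [edvd uR nqu pE]]] :=
    @galois_ramification L R R_order q p R_inv qR Nq pp Prq.
  apply: (rational_prime_criterion R_order f_R deg_f Prp Prq Nq uR pE nqu).
  by move: co_nm; rewrite -dimK; apply: coprime_dvdr.
- move=> delta alpha p a b c l _ [alpha3 _] _ alpha_deg R_def Prp np3 npm3 co_pd.
  move=> q Prq Nq _.
  have [z [zR pE nqz]] := cubic_unramified alpha3 alpha_deg R_def R_order Prp
    np3 npm3 co_pd Prq Nq.
  apply: (rational_prime_criterion R_order f_R deg_f Prp Prq Nq zR pE nqz).
  exact: coprimen1.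
Qed.
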